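(* Let $(A,A_r^* )$ be a quasi-triangular Zinbiel bialgebra induced by $r\in A\otimes A$. Then $r_+:(A^*,\cdot_+)\to(A,\circ_A)$ is a relative Rota-Baxter operator of weight $-1$ with respect to the action $(-L^*-R^*,R^* )$ of $(A,\circ_A)$ on $(A^*,\cdot_+)$.
   Context: All vector spaces are finite-dimensional over a field $\mathbb{K}$ of characteristic different from $2$. A Zinbiel algebra $(A,\circ_A)$ is a vector space with a bilinear product satisfying $x\circ_A(y\circ_A z)=(x\circ_A y+y\circ_A x)\circ_A z$. Write $x\ast_A y=x\circ_A y+y\circ_A x$, $L_x(y)=x\circ_A y$, $R_x(y)=y\circ_A x$, $\langle L_x^*\xi,y\rangle=-\langle\xi,x\circ_A y\rangle$, $\langle R_x^*\xi,y\rangle=-\langle\xi,y\circ_A x\rangle$ ($\xi\in A^*$). For $r=\sum_i a_i\otimes b_i\in A\otimes A$ define $r_\pm:A^*\to A$ by $\langle r_+(\xi),\eta\rangle=r(\xi,\eta)=\langle\xi,r_-(\eta)\rangle$, put $I=r_+-r_-$, let $a$ be the skew-symmetric part of $r$, and let $$[\![r,r]\!]=\sum_{i,j}\big(-a_i\circ_A a_j\otimes b_j\otimes b_i-b_j\otimes a_i\circ_A a_j\otimes b_i+a_i\ast_A b_j\otimes a_j\otimes b_i+a_i\otimes b_i\ast_A a_j\otimes b_j-a_i\otimes a_j\otimes b_i\ast_A b_j\big).$$ An element $s\in A\otimes A$ is $(L,L+R)$-invariant if $(L_x\otimes\mathrm{Id}-\mathrm{Id}\otimes(L_x+R_x))s=0$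 for all $x\in A$. If $[\![r,r]\!]=0$ and $a$ is $(L,L+R)$-invariant, then $\alpha(x)=(\mathrm{Id}\otimes(L_x+R_x)-L_x\otimes\mathrm{Id})r$ makes $(A,A^* )$ a Zinbiel bialgebra with product $\xi\cdot_r\eta=-(L^*_{r_+(\xi)}+R^*_{r_+(\xi)})\eta+R^*_{r_-(\eta)}\xi$ on $A^*$ (denoted $A_r^*$); this $(A,A_r^* )$ is called the quasi-triangular Zinbiel bialgebra induced by $r$. (A Zinbiel bialgebra is a pair of Zinbiel algebra structures on $A$ and $A^*$, dual to maps $\beta:A^*\to A^*\otimes A^*$ and $\alpha:A\to A\otimes A$ respectively, with $\alpha(x\ast_A y)=(L_x\otimes\mathrm{Id})\alpha(y)+(\mathrm{Id}\otimes(L_y+R_y))\alpha(x)$ and $\beta(\xi\ast_{A^*}\eta)=(\mathcal{L}_\xi\otimes\mathrm{Id})\beta(\eta)+(\mathrm{Id}\otimes(\mathcal{L}_\eta+\mathcal{R}_\eta))\beta(\xi)$, where $\mathcal{L},\mathcal{R}$ are left and right multiplications of $A^*$ and $\xi\ast_{A^*}\eta$ is the symmetrized product of $A^*$.) The product $\cdot_+$ on $A^*$ is $\xi\cdot_+\eta=R^*_{I\eta}\xi$; in this situation it is a Zinbiel product and $(-L^*-R^*,R^* )$ is an action of $(A,\circ_A)$ on $(A^*,\cdot_+)$. Action: for Zinbiel algebras $(A,\circ_A)$, $(B,\circ_B)$, an action of $A$ on $B$ is a pair of linear maps $\rho,\mu:A\to\mathrm{End}(B)$ such that $(B;\rho,\mu)$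 is a representation, i.e. $\rho(x)\rho(y)=\rho(x\circ_A y)+\rho(y\circ_A x)$, $\rho(x)\mu(y)=\mu(x\circ_A y)=\mu(y)\rho(x)+\mu(y)\mu(x)$, and moreover $u\circ_B(\mu(x)v)=\mu(x)(u\circ_B v+v\circ_B u)$, $u\circ_B(\rho(x)v)=(\mu(x)u)\circ_B v+(\rho(x)u)\circ_B v$, $\rho(x)(u\circ_B v)=(\mu(x)u)\circ_B v+(\rho(x)u)\circ_B v$ for all $x,y\in A$, $u,v\in B$. Relative Rota-Baxter operator of weight $\lambda$ with respect to the action $(\rho,\mu)$ of $A$ on $B$: a linear map $T:B\to A$ with $(Tu)\circ_A(Tv)=T(\rho(Tu)v+\mu(Tv)u+\lambda\,u\circ_B v)$ for all $u,v\in B$. *)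

(* Defs.v *)
From HB Require Import structures.
From mathcomp Require Import all_boot all_order all_algebra.

Set Implicit Arguments.
Unset Strict Implicit.
Unset Printing Implicit Defensive.

Import GRing.Theory VectorInternalTheory.
Local Open Scope ring_scope.

Definition dual (K : fieldType) (A : vectType K) : vectType K := 'Hom(A, K^o).

(* U (x) V is modelled by matrices of coordinates with respect to e_i (x) e_j,
   where (e_i) is the basis underlying the vectType structure. The lemmas
   below show that this is the tensor product: [tlift b] is the unique linear
   map with [tlift b (u \ox v) = b u v] for bilinear [b]. *)
Definition tensor (K : fieldType) (U V : vectType K) : vectType K :=
  'M[K]_(dim U, dim V).

Definition std_vec (K : fieldType) (U : vectType K) (i : 'I_(dim U)) : U :=
  r2v (delta_mx 0 i).

Section Tensor.
Variable K : fieldType.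
Implicit Types U V W : vectType K.

Definition tens U V (u : U) (v : V) : tensor U V := (v2r u)^T *m v2r v.

Definition tlift U V W (b : U -> V -> W) (s : tensor U V) : W :=
  \sum_(i < dim U) \sum_(j < dim V)
    (s : 'M[K]_(dim U, dim V)) i j *: b (std_vec i) (std_vec j).

End Tensor.

Notation "u \ox v" := (tens u v) (at level 40, left associativity).

Section TensorTheory.
Variable K : fieldType.
Implicit Types U V W : vectType K.

Lemma std_vec_sum U (u : U) : u = \sum_i (v2r u) 0 i *: std_vec i.
Proof.
rewrite -{1}[u]v2rK {1}[v2r u]row_sum_delta linear_sum.
by apply: eq_bigr => i _; rewrite linearZ.
Qed.

Lemma tens_linearl U V (v : V) : linear (fun u : U => u \ox v).
Proof.
by move=> c u u'; rewrite /tens !linearP mulmxDl -scalemxAl.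
Qed.

Lemma tens_linearr U V (u : U) : linear (fun v : V => u \ox v).
Proof. by move=> c v v'; rewrite /tens !linearP. Qed.

HB.instance Definition _ U V :=
  bilinear_isBilinear.Build K U V (tensor U V) *:%R *:%R (@tens K U V)
    (@tens_linearl U V, @tens_linearr U V).

Lemma tlift_is_linear U V W (b : U -> V -> W) : linear (tlift b).
Proof.
move=> c s t; rewrite /tlift scaler_sumr -big_split; apply: eq_bigr => i _.
rewrite scaler_sumr -big_split; apply: eq_bigr => j _.
by rewrite !mxE scalerDl scalerA.
Qed.

HB.instance Definition _ U V W (b : U -> V -> W) :=
  GRing.isLinear.Build K (tensor U V) W *:%R (tlift b) (tlift_is_linear b).

Lemma tlift_tens U V W (b : {bilinear U -> V -> W}) u v :
  tlift b (u \ox v) = b u v.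
Proof.
rewrite [in RHS](std_vec_sum u) linear_sumlz; apply: eq_bigr => i _.
rewrite [in RHS](std_vec_sum v) linear_sumr; apply: eq_bigr => j _.
by rewrite linearZl_LR linearZr_LR scalerA mxE big_ord1 mxE.
Qed.

Lemma tens_span U V (s : tensor U V) :
  exists n (a : 'I_n -> U) (b : 'I_n -> V), s = \sum_(i < n) a i \ox b i.
Proof.
exists (dim U), (@std_vec _ U), (fun i => r2v (row i (s : 'M_(_, _)))).
rewrite {1}[s]matrix_sum_delta; apply: eq_bigr => i _.
rewrite /tens /std_vec !r2vK [in RHS](row_sum_delta (row i s)) linear_sum.
apply: eq_bigr => j _; rewrite linearZ /= mxE; congr (_ *: _).
by rewrite trmx_delta mul_delta_mx.
Qed.

Lemma tlift_unique U V W (f : {linear tensor U V -> W}) (s : tensor U V) :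
  f s = tlift (fun u v => f (u \ox v)) s.
Proof.
rewrite {1}[s]matrix_sum_delta linear_sum; apply: eq_bigr => i _.
rewrite linear_sum; apply: eq_bigr => j _; rewrite linearZ /=.
by rewrite /tens /std_vec !r2vK trmx_delta mul_delta_mx.
Qed.

Definition flip U V : tensor U V -> tensor V U := tlift (fun u v => v \ox u).

Definition tmap U U' V V' (f : 'Hom(U, U')) (g : 'Hom(V, V')) :
    tensor U V -> tensor U' V' :=
  tlift (fun u v => f u \ox g v).

(* r(xi, eta): the evaluation of a 2-tensor on a pair of linear forms. *)
Definition tform U V (r : tensor U V) (xi : dual U) (eta : dual V) : K :=
  tlift (fun u v => xi u * eta v : K^o) r.

Definition skew_part U (r : tensor U U) : tensor U U :=
  2%:R^-1 *: (r - flip r).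

Lemma bilin_lift U V W (b : U -> V -> W) :
  (forall v, linear (b^~ v)) -> (forall u, linear (b u)) ->
  forall u v, tlift b (u \ox v) = b u v.
Proof.
move=> bl br u v.
pose m := bilinear_isBilinear.Build K U V W *:%R *:%R b (bl, br).
pose B : {bilinear U -> V -> W} := HB.pack b m.
exact: (tlift_tens B).
Qed.

Lemma flip_tens U V (u : U) (v : V) : flip (u \ox v) = v \ox u.
Proof.
rewrite /flip bilin_lift //.
  by move=> x c y z; rewrite linearPr.
by move=> x c y z; rewrite linearPl.
Qed.

Lemma tmap_tens U U' V V' (f : 'Hom(U, U')) (g : 'Hom(V, V')) u v :
  tmap f g (u \ox v) = f u \ox g v.
Proof.
rewrite /tmap bilin_lift //.
  by move=> x c y z; rewrite linearP linearPl.
by move=> x c y z; rewrite linearP linearPr.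
Qed.

Lemma tform_tens U V (u : U) (v : V) (xi : dual U) (eta : dual V) :
  tform (u \ox v) xi eta = xi u * eta v.
Proof.
rewrite /tform bilin_lift // => x c y z; rewrite linearP /=.
  by rewrite mulrDl -mulrA.
by rewrite mulrDr mulrCA.
Qed.

End TensorTheory.

Section RMaps.
Variables (K : fieldType) (A : vectType K).
Implicit Types (r : tensor A A) (xi eta : dual A).

Definition r_plus_fun r xi : A := tlift (fun a b => (xi a : K) *: b) r.
Definition r_minus_fun r eta : A := tlift (fun a b => (eta b : K) *: a) r.

Lemma r_plus_is_linear r : linear (r_plus_fun r).
Proof.
move=> c x y; rewrite /r_plus_fun /tlift scaler_sumr -big_split.
apply: eq_bigr => i _; rewrite scaler_sumr -big_split; apply: eq_bigr => j _.
rewrite !lfunE /= scalerDl scalerDr !scalerA; congr (_ *: _ + _).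
by rewrite scale_lfunE [RHS]mulrCA.
Qed.

Lemma r_minus_is_linear r : linear (r_minus_fun r).
Proof.
move=> c x y; rewrite /r_minus_fun /tlift scaler_sumr -big_split.
apply: eq_bigr => i _; rewrite scaler_sumr -big_split; apply: eq_bigr => j _.
rewrite !lfunE /= scalerDl scalerDr !scalerA; congr (_ *: _ + _).
by rewrite scale_lfunE [RHS]mulrCA.
Qed.

HB.instance Definition _ r :=
  GRing.isLinear.Build K (dual A) A *:%R (r_plus_fun r) (r_plus_is_linear r).
HB.instance Definition _ r :=
  GRing.isLinear.Build K (dual A) A *:%R (r_minus_fun r) (r_minus_is_linear r).

Definition r_plus r : 'Hom(dual A, A) := linfun (r_plus_fun r).
Definition r_minus r : 'Hom(dual A, A) := linfun (r_minus_fun r).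
Definition r_I r : 'Hom(dual A, A) := r_plus r - r_minus r.

(* These two identities are what defines r_+ and r_-. *)
Lemma r_plusP r xi eta : eta (r_plus r xi) = tform r xi eta.
Proof.
rewrite lfunE /= /r_plus_fun /tform /tlift linear_sum; apply: eq_bigr => i _.
rewrite linear_sum; apply: eq_bigr => j _; rewrite linearZ /=.
by congr (_ *: _); rewrite linearZ.
Qed.

Lemma r_minusP r xi eta : xi (r_minus r eta) = tform r xi eta.
Proof.
rewrite lfunE /= /r_minus_fun /tform /tlift linear_sum; apply: eq_bigr => i _.
rewrite linear_sum; apply: eq_bigr => j _; rewrite linearZ /=.
by congr (_ *: _); rewrite linearZ [RHS]mulrC.
Qed.

End RMaps.

Section Zinbiel.
Variables (K : fieldType) (A : vectType K) (circ : {bilinear A -> A -> A}).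

Definition sym_prod (x y : A) : A := circ x y + circ y x.

Definition is_zinbiel : Prop :=
  forall x y z, circ x (circ y z) = circ (sym_prod x y) z.

Definition Lmul (x : A) : 'End(A) := linfun (circ x).
Definition Rmul (x : A) : 'End(A) := linfun (applyr circ x).

Lemma LmulE x y : Lmul x y = circ x y. Proof. by rewrite lfunE. Qed.
Lemma RmulE x y : Rmul x y = circ y x. Proof. by rewrite lfunE. Qed.

Definition Lstar_fun (x : A) (xi : dual A) : dual A := - (xi \o Lmul x)%VF.
Definition Rstar_fun (x : A) (xi : dual A) : dual A := - (xi \o Rmul x)%VF.

Lemma Lstar_fun_linear x : linear (Lstar_fun x).
Proof.
by move=> c xi eta; rewrite /Lstar_fun comp_lfunDl -comp_lfunZl opprD scalerN.
Qed.
Lemma Rstar_fun_linear x : linear (Rstar_fun x).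
Proof.
by move=> c xi eta; rewrite /Rstar_fun comp_lfunDl -comp_lfunZl opprD scalerN.
Qed.

HB.instance Definition _ x :=
  GRing.isLinear.Build K (dual A) (dual A) *:%R (Lstar_fun x)
    (Lstar_fun_linear x).
HB.instance Definition _ x :=
  GRing.isLinear.Build K (dual A) (dual A) *:%R (Rstar_fun x)
    (Rstar_fun_linear x).

Definition Lstar (x : A) : 'End(dual A) := linfun (Lstar_fun x).
Definition Rstar (x : A) : 'End(dual A) := linfun (Rstar_fun x).

Lemma LstarE x xi y : Lstar x xi y = - xi (circ x y).
Proof. by rewrite lfunE /= /Lstar_fun opp_lfunE comp_lfunE LmulE. Qed.
Lemma RstarE x xi y : Rstar x xi y = - xi (circ y x).
Proof. by rewrite lfunE /= /Rstar_fun opp_lfunE comp_lfunE RmulE. Qed.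

Lemma Lstar_is_linear : linear Lstar.
Proof.
move=> c x y; apply/lfunP => xi; rewrite add_lfunE scale_lfunE.
apply/lfunP => z; rewrite add_lfunE scale_lfunE !LstarE linearPl linearP /=.
by rewrite opprD scalerN.
Qed.
Lemma Rstar_is_linear : linear Rstar.
Proof.
move=> c x y; apply/lfunP => xi; rewrite add_lfunE scale_lfunE.
apply/lfunP => z; rewrite add_lfunE scale_lfunE !RstarE linearPr linearP /=.
by rewrite opprD scalerN.
Qed.

HB.instance Definition _ :=
  GRing.isLinear.Build K A 'End(dual A) *:%R Lstar Lstar_is_linear.
HB.instance Definition _ :=
  GRing.isLinear.Build K A 'End(dual A) *:%R Rstar Rstar_is_linear.

(* The map x |-> - L_x^* - R_x^*, first half of the action on A^*. *)
Definition rho_dual (x : A) : 'End(dual A) := - Lstar x - Rstar x.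

Lemma rho_dual_is_linear : linear rho_dual.
Proof.
move=> c x y; rewrite /rho_dual (linearP Lstar) (linearP Rstar) !opprD.
by rewrite scalerDr !scalerN addrACA.
Qed.

HB.instance Definition _ :=
  GRing.isLinear.Build K A 'End(dual A) *:%R rho_dual rho_dual_is_linear.

(* (L, L+R)-invariance *)
Definition invariant (s : tensor A A) : Prop :=
  forall x, tmap (Lmul x) \1%VF s - tmap \1%VF (Lmul x + Rmul x) s = 0.

(* [[r, r]], expanded along r = sum_i a (x) b = sum_j a' (x) b', where
   a, b, a', b' stand for a_i, b_i, a_j, b_j; see [bracketE]. *)
Definition bracket (r : tensor A A) : tensor (tensor A A) A :=
  tlift (fun a b => tlift (fun a' b' =>
      - (circ a a' \ox b' \ox b)
      - (b' \ox circ a a' \ox b)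
      + (sym_prod a b' \ox a' \ox b)
      + (a \ox sym_prod b a' \ox b')
      - (a \ox a' \ox sym_prod b b')) r) r.

(* r induces a quasi-triangular Zinbiel bialgebra (A, A_r^* ). That the
   resulting pair satisfies the bialgebra axioms is a consequence of these two
   conditions, not a further requirement. *)
Definition quasi_triangular (r : tensor A A) : Prop :=
  bracket r = 0 /\ invariant (skew_part r).

(* xi ._+ eta *)
Definition plus_prod (r : tensor A A) (xi eta : dual A) : dual A :=
  Rstar (r_I r eta) xi.

Lemma plus_prod_bilinear r :
  bilinear_for *:%R *:%R (plus_prod r).
Proof.
split=> [eta|xi] c x y; rewrite /plus_prod; first by rewrite linearP.
by rewrite !linearP /= add_lfunE scale_lfunE.
Qed.

HB.instance Definition _ r :=
  bilinear_isBilinear.Build K (dual A) (dual A) (dual A) *:%R *:%R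
    (plus_prod r) (plus_prod_bilinear r).

End Zinbiel.

Section BracketTheory.
Variables (K : fieldType) (A : vectType K) (circ : {bilinear A -> A -> A}).

Lemma tlift_sum2 (W : vectType K) (g : A -> A -> A -> A -> W) :
  (forall b a' b', linear (fun a => g a b a' b')) ->
  (forall a a' b', linear (fun b => g a b a' b')) ->
  (forall a b b', linear (fun a' => g a b a' b')) ->
  (forall a b a', linear (fun b' => g a b a' b')) ->
  forall n (a b : 'I_n -> A), let r := \sum_i a i \ox b i in
  tlift (fun x y => tlift (g x y) r) r =
  \sum_i \sum_j g (a i) (b i) (a j) (b j).
Proof.
move=> g1 g2 g3 g4 n a b r.
have inner x y : tlift (g x y) r = \sum_j g x y (a j) (b j).
  rewrite linear_sum; apply: eq_bigr => j _.
  by apply: (bilin_lift (b := g x y)) => [b'|a'] ; [exact: g3 | exact: g4].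
rewrite {2}/r linear_sum; apply: eq_bigr => i _ /=.
rewrite (bilin_lift (b := fun x y => tlift (g x y) r)) ?inner //.
  move=> y c u v; rewrite !inner scaler_sumr -big_split.
  by apply: eq_bigr => j _; exact: g1.
move=> x c u v; rewrite !inner scaler_sumr -big_split.
by apply: eq_bigr => j _; exact: g2.
Qed.

Lemma bracketE n (a b : 'I_n -> A) :
  bracket circ (\sum_i a i \ox b i) =
  \sum_i \sum_j
    (- (circ (a i) (a j) \ox b j \ox b i)
     - (b j \ox circ (a i) (a j) \ox b i)
     + (sym_prod circ (a i) (b j) \ox a j \ox b i)
     + (a i \ox sym_prod circ (b i) (a j) \ox b j)
     - (a i \ox a j \ox sym_prod circ (b i) (b j))).
Proof.
pose g (x y x' y' : A) : tensor (tensor A A) A :=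
  - (circ x x' \ox y' \ox y) - (y' \ox circ x x' \ox y)
  + (sym_prod circ x y' \ox x' \ox y) + (x \ox sym_prod circ y x' \ox y')
  - (x \ox x' \ox sym_prod circ y y').
have E (W : lmodType K) (c : K) (u1 u2 u3 u4 u5 v1 v2 v3 v4 v5 : W) :
  - (c *: u1 + v1) - (c *: u2 + v2) + (c *: u3 + v3) + (c *: u4 + v4)
    - (c *: u5 + v5) =
  c *: (- u1 - u2 + u3 + u4 - u5) + (- v1 - v2 + v3 + v4 - v5).
  have addP (u v u' v' : W) : (c *: u + v) + (c *: u' + v') =
    c *: (u + u') + (v + v') by rewrite addrACA scalerDr.
  have oppP (u v : W) : - (c *: u + v) = c *: (- u) + - v.
    by rewrite opprD scalerN.
  by rewrite !oppP !addP.
have symPl (c : K) u v y : sym_prod circ (c *: u + v) y =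
    c *: sym_prod circ u y + sym_prod circ v y.
  by rewrite /sym_prod linearPl linearPr scalerDr addrACA.
have symPr (c : K) u v y : sym_prod circ y (c *: u + v) =
    c *: sym_prod circ y u + sym_prod circ y v.
  by rewrite /sym_prod linearPl linearPr scalerDr addrACA.
by rewrite /bracket (tlift_sum2 (g := g)) // => ??? c u v;
  rewrite /g ?(symPl, symPr, linearPl, linearPr) E.
Qed.

End BracketTheory.

Section Action.
Variables (K : fieldType) (A B : vectType K).
Variables (cA : {bilinear A -> A -> A}) (cB : {bilinear B -> B -> B}).
Variables (rho mu : {linear A -> 'End(B)}).

Definition is_representation : Prop :=
  (forall x y, (rho x \o rho y)%VF = rho (cA x y) + rho (cA y x)) /\
  (forall x y, (rho x \o mu y)%VF = mu (cA x y) /\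
     mu (cA x y) = (mu y \o rho x)%VF + (mu y \o mu x)%VF).

Definition is_action : Prop :=
  is_representation /\
  forall x u v,
    [/\ cB u (mu x v) = mu x (cB u v + cB v u),
        cB u (rho x v) = cB (mu x u) v + cB (rho x u) v &
        rho x (cB u v) = cB (mu x u) v + cB (rho x u) v].

(* The requirement that A and B are Zinbiel algebras and that (rho, mu) is an
   action is part of the predicate. *)
Definition is_relative_rota_baxter (lambda : K) (T : 'Hom(B, A)) : Prop :=
  [/\ is_zinbiel cA, is_zinbiel cB, is_action &
      forall u v, cA (T u) (T v) =
        T (rho (T u) v + mu (T v) u + lambda *: cB u v)].

End Action.

(* Main.v *)
(* Write I = r_+ - r_-. Invariance of the skew part of r says that
   I (beta o L_x) = x * I beta, and skewness turns this into
   alpha (x * I beta) = - beta (x o I alpha), hence I (beta o R_x) = - I beta o x.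
   These identities reduce the Zinbiel and action axioms for ._+ to identities
   in A. For the Rota-Baxter identity, the weight -1 term replaces r_+ eta by
   r_- eta, and the identity to be proved, tested on zeta, becomes
     zeta (r_+ xi o r_+ eta) = eta (r_+ xi * r_- zeta) - xi (r_- zeta o r_- eta).
   This is not [[r, r]](xi, eta, zeta) = 0, which only gives the part symmetric
   in xi and eta, but [[r, r]](zeta, xi, eta) = 0, up to terms in I that cancel
   by invariance. *)
Require Import Defs.
From mathcomp Require Import all_boot all_order all_algebra.
From mathcomp Require Import ring.

Set Implicit Arguments.
Unset Strict Implicit.
Unset Printing Implicit Defensive.

Import GRing.Theory.
Local Open Scope ring_scope.

(** * Evaluating tensors on linear forms *)

Section TensorForms.
Variable K : fieldType.
Implicit Types U V W : vectType K.

(* linearD and linearN would state these in the ring K^o, on which ring fails. *)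
Lemma formD U (xi : dual U) u v : xi (u + v) = (xi u : K) + xi v :> K.
Proof. exact: (linearD xi). Qed.

Lemma formN U (xi : dual U) u : xi (- u) = - (xi u : K) :> K.
Proof. exact: (linearN xi). Qed.

(** The coordinates in a basis are themselves linear forms. *)
Lemma form_inj U (u v : U) : (forall xi : dual U, xi u = xi v) -> u = v.
Proof.
move=> uv; rewrite (coord_vbasis (memvf u)) (coord_vbasis (memvf v)).
apply: eq_bigr => i _; congr (_ *: _).
by have := uv (linfun (coord (vbasis fullv) i : U -> K^o)); rewrite !lfunE.
Qed.

Lemma tform_sum_tens U V n (a : 'I_n -> U) (b : 'I_n -> V) xi eta :
  tform (\sum_i a i \ox b i) xi eta = \sum_i xi (a i) * eta (b i).
Proof.
by rewrite /tform linear_sum; apply: eq_bigr => i _; exact: tform_tens.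
Qed.

Lemma tform_tmap U U' V V' (f : 'Hom(U, U')) (g : 'Hom(V, V'))
    (s : tensor U V) xi eta :
  tform (tmap f g s) xi eta = tform s (xi \o f)%VF (eta \o g)%VF.
Proof.
have [n [a [b ->]]] := tens_span s.
rewrite {1}/tmap linear_sum -/(tmap f g).
rewrite (eq_bigr (fun i => f (a i) \ox g (b i))); last first.
  by move=> i _; exact: tmap_tens.
by rewrite !tform_sum_tens; apply: eq_bigr => i _; rewrite !comp_lfunE.
Qed.

Lemma tform_flip U V (s : tensor U V) xi eta :
  tform (flip s) xi eta = tform s eta xi.
Proof.
have [n [a [b ->]]] := tens_span s.
rewrite /flip linear_sum (eq_bigr (fun i => b i \ox a i)); last first.
  by move=> i _; exact: flip_tens.
by rewrite !tform_sum_tens; apply: eq_bigr => i _; rewrite mulrC.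
Qed.

Definition tform3 U V W (xi : dual U) (eta : dual V) (zeta : dual W) :
    dual (tensor (tensor U V) W) :=
  let xi_eta := linfun (tlift (fun u v => xi u * eta v : K^o)) in
  linfun (tlift (fun s w => xi_eta s * zeta w : K^o)).

Lemma tform3_tens U V W (xi : dual U) (eta : dual V) (zeta : dual W) u v w :
  tform3 xi eta zeta (u \ox v \ox w) = xi u * eta v * zeta w :> K.
Proof.
by rewrite /tform3 lfunE /= [LHS]tform_tens lfunE /= [tlift _ _]tform_tens.
Qed.

End TensorForms.

(** * The bracket and the map I in terms of forms *)

Section QuasiTriangular.
Variables (K : fieldType) (A : vectType K) (circ : {bilinear A -> A -> A}).
Variable r : tensor A A.
Implicit Types (x y z : A) (xi eta zeta : dual A).

Local Notation rp := (r_plus r).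
Local Notation rm := (r_minus r).
Local Notation I := (r_I r).

Lemma r_plus_tens n (a b : 'I_n -> A) xi :
  r_plus (\sum_i a i \ox b i) xi = \sum_i (xi (a i) : K) *: b i.
Proof.
rewrite lfunE /= /r_plus_fun linear_sum; apply: eq_bigr => i _.
apply: (bilin_lift (b := fun u v => (xi u : K) *: v)) => [v|u] c x y.
  by rewrite linearP scalerDl scalerA.
by rewrite scalerDr !scalerA mulrC.
Qed.

Lemma r_minus_tens n (a b : 'I_n -> A) eta :
  r_minus (\sum_i a i \ox b i) eta = \sum_i (eta (b i) : K) *: a i.
Proof.
rewrite lfunE /= /r_minus_fun linear_sum; apply: eq_bigr => i _.
apply: (bilin_lift (b := fun u v => (eta v : K) *: u)) => [v|u] c x y.
  by rewrite scalerDr !scalerA mulrC.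
by rewrite linearP scalerDl scalerA.
Qed.

Lemma form_circ_sum n (c d : 'I_n -> K) (u v : 'I_n -> A) (xi : dual A) :
  xi (circ (\sum_i c i *: u i) (\sum_i d i *: v i)) =
  \sum_i \sum_j c i * d j * (xi (circ (u i) (v j)) : K) :> K.
Proof.
rewrite linear_sumlz linear_sum; apply: eq_bigr => i _.
rewrite linear_sumr linear_sum; apply: eq_bigr => j _.
by rewrite linearZl_LR linearZr_LR !linearZ /=; exact: mulrA.
Qed.

Lemma form_sym_prod_sum n (c d : 'I_n -> K) (u v : 'I_n -> A) (xi : dual A) :
  xi (sym_prod circ (\sum_i c i *: u i) (\sum_i d i *: v i)) =
  \sum_i \sum_j c i * d j * (xi (sym_prod circ (u i) (v j)) : K) :> K.
Proof.
rewrite /sym_prod linearD /= !form_circ_sum [X in _ + X]exchange_big -big_split.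
apply: eq_bigr => i _; rewrite -big_split; apply: eq_bigr => j _.
by rewrite linearD /= mulrDr [d j * _]mulrC.
Qed.

(** In each summand of the bracket two forms meet single legs of r and the third meets a product;
    pairing with a first leg leaves [rp], with a second leg [rm]. *)
Lemma tform3_bracket xi eta zeta :
  tform3 xi eta zeta (bracket circ r) =
  - (xi (circ (rm zeta) (rm eta)) : K) - eta (circ (rm zeta) (rm xi))
  + xi (sym_prod circ (rm zeta) (rp eta))
  + eta (sym_prod circ (rp xi) (rm zeta))
  - zeta (sym_prod circ (rp xi) (rp eta)).
Proof.
have [n [a [b ->]]] := tens_span r.
rewrite bracketE linear_sum /= !r_plus_tens !r_minus_tens.
rewrite !form_circ_sum !form_sym_prod_sum -!sumrN -!big_split.
apply: eq_bigr => i _; rewrite linear_sum /= -!sumrN -!big_split.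
apply: eq_bigr => j _; rewrite !(formD, formN) !tform3_tens /sym_prod !formD /=.
by ring.
Qed.

Lemma r_minusE xi : rm xi = rp xi - I xi.
Proof. by rewrite add_lfunE opp_lfunE subKr. Qed.

Lemma r_I_form xi eta :
  eta (I xi) = (tform r xi eta : K) - tform r eta xi :> K.
Proof. by rewrite add_lfunE opp_lfunE formD formN r_plusP r_minusP. Qed.

Lemma r_I_skew xi eta : xi (I eta) = - (eta (I xi) : K) :> K.
Proof. by rewrite !r_I_form opprB. Qed.

Lemma tform_skew_part xi eta :
  tform (skew_part r) xi eta = 2%:R^-1 * (eta (I xi) : K).
Proof.
rewrite /skew_part /tform linearZ linearB /= -!/(tform _ _ _) tform_flip.
by rewrite r_I_form.
Qed.

Lemma rho_dualE x xi y : rho_dual circ x xi y = xi (sym_prod circ x y) :> K.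
Proof.
rewrite /rho_dual !(add_lfunE, opp_lfunE).
by rewrite LstarE RstarE !opprK -formD.
Qed.

Lemma plus_prodE xi eta y :
  plus_prod circ r xi eta y = - (xi (circ y (I eta)) : K) :> K.
Proof. by rewrite RstarE. Qed.

Lemma sym_prodC x y : sym_prod circ x y = sym_prod circ y x.
Proof. by rewrite /sym_prod addrC. Qed.

(** * Consequences of invariance *)

Hypothesis K_char : 2%N \notin [pchar K].
Hypothesis r_inv : Defs.invariant circ (skew_part r).

Lemma invariant_form x xi eta :
  xi (sym_prod circ x (I eta)) = - (eta (circ x (I xi)) : K) :> K.
Proof.
(* The skew part of r is half of I as a form. In characteristic 2 the factor [2%:R^-1] would be 0
   and invariance would say nothing about I. *)
have two_neq0 : (2%:R : K) != 0.
  by apply: contraNneq K_char => two0; rewrite inE /= two0 eqxx.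
have := congr1 (fun t : tensor A A => tform t eta xi) (r_inv x).
rewrite /tform linearB linear0 /= -!/(tform _ _ _) !tform_tmap.
rewrite !tform_skew_part -mulrBr => /eqP.
rewrite mulf_eq0 invr_eq0 (negPf two_neq0) /= subr_eq0 => /eqP.
rewrite !comp_lfun1r r_I_skew !comp_lfunE.
by rewrite [(Lmul _ _ + _)%R _]add_lfunE !LmulE RmulE.
Qed.

(** Tested on eta, both sides equal - xi (x o I eta) - eta (x o I xi), by invariance with xi and eta
    in either order. *)
Lemma r_I_Rstar x xi : I (Rstar circ x xi) = circ (I xi) x.
Proof.
apply: form_inj => eta; rewrite r_I_skew RstarE opprK.
have := invariant_form x eta xi; have := invariant_form x xi eta.
rewrite /sym_prod !formD => /(canRL (addKr _)) -> /(canRL (addKr _)) ->.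
exact: addrC.
Qed.

Lemma r_I_plus_prod xi eta : I (plus_prod circ r xi eta) = circ (I xi) (I eta).
Proof. exact: r_I_Rstar. Qed.

(** With [r_I_Rstar], this makes I intertwine the action on the dual with left and right
    multiplication in A. *)
Lemma r_I_rho_dual x xi : I (rho_dual circ x xi) = circ x (I xi).
Proof.
by apply: form_inj => eta; rewrite r_I_skew rho_dualE invariant_form opprK.
Qed.

(** * The Zinbiel and action axioms on the dual *)

Hypothesis A_zinbiel : is_zinbiel circ.

Lemma circCA x y z : circ x (circ y z) = circ y (circ x z).
Proof. by rewrite !A_zinbiel sym_prodC. Qed.

(** By duality this yields the axiom on [rho_dual] composed with itself. *)
Lemma sym_prodA x y z :
  sym_prod circ x (sym_prod circ y z) = sym_prod circ (sym_prod circ x y) z.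
Proof.
have symE u v : sym_prod circ u v = circ u v + circ v u by [].
rewrite [LHS]symE [RHS]symE -!A_zinbiel !symE !linearDr /=.
by rewrite (circCA z x) (circCA z y) addrA.
Qed.

(** Invariance replaces - eta (z o I xi) by xi (z * I eta), and the terms xi (z o I eta) cancel. *)
Lemma plus_prod_sym xi eta :
  plus_prod circ r xi eta + plus_prod circ r eta xi = - Lstar circ (I eta) xi.
Proof.
apply/lfunP => z; rewrite add_lfunE opp_lfunE !plus_prodE LstarE opprK.
have := invariant_form z xi eta; rewrite /sym_prod formD => h.
by rewrite -[- (eta _ : K)]h addKr.
Qed.

Lemma plus_prod_zinbiel : is_zinbiel (plus_prod circ r).
Proof.
move=> xi eta zeta; rewrite /sym_prod plus_prod_sym; apply/lfunP => y /=.
rewrite !plus_prodE opp_lfunE LstarE opprK.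
by rewrite r_I_plus_prod circCA.
Qed.

Lemma dual_action :
  is_action circ (plus_prod circ r) (rho_dual circ) (Rstar circ).
Proof.
split; first split.
- move=> x y; apply/lfunP => xi; apply/lfunP => z.
  rewrite comp_lfunE !rho_dualE 2!add_lfunE !rho_dualE -formD.
  by rewrite sym_prodA (sym_prodC y) /sym_prod !linearDl !linearDr /= addrACA.
- move=> x y; split; apply/lfunP => xi; apply/lfunP => z.
    by rewrite comp_lfunE rho_dualE !RstarE A_zinbiel (sym_prodC z).
  (* Here and in the last two clauses of the action, [rho_dual] plus [Rstar] collapses to minus
     [Lstar], as the right multiplications cancel. *)
  rewrite 2!add_lfunE !comp_lfunE !RstarE rho_dualE -!formN.
  by rewrite -formD opprK /sym_prod opprD addrNK circCA.
move=> x u v; split; apply/lfunP => y.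
- rewrite plus_prod_sym /= plus_prodE r_I_Rstar RstarE opp_lfunE LstarE opprK.
  by rewrite circCA.
- rewrite /= plus_prodE r_I_rho_dual [RHS]add_lfunE !plus_prodE rho_dualE RstarE.
  rewrite -!formN -formD opprK /sym_prod opprD [_ + (_ - _)]addrC.
  by rewrite addrNK circCA.
rewrite /= rho_dualE [RHS]add_lfunE !plus_prodE rho_dualE RstarE.
rewrite -!formN -formD opprK /sym_prod opprD [_ + (_ - _)]addrC.
by rewrite addrNK A_zinbiel.
Qed.

(** * The Rota-Baxter identity *)

Hypothesis r_bracket : bracket circ r = 0.

Lemma bracket_form xi eta zeta :
  zeta (circ (rp xi) (rp eta)) =
  (eta (sym_prod circ (rp xi) (rm zeta)) : K)
  - xi (circ (rm zeta) (rm eta)) :> K.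
Proof.
have pI al be ga := invariant_form (rp al) be ga.
have II al be ga := invariant_form (I al) be ga.
have := tform3_bracket zeta xi eta; rewrite r_bracket linear0 !r_minusE.
(* With [rm] written as [rp] minus I, invariance at [I eta], [rp eta] and [rp xi] makes the
   difference of the two sides equal to the value of the bracket. *)
have := II eta xi zeta; have := pI eta xi zeta; have := pI xi eta zeta.
rewrite /sym_prod !(linearBl, linearBr) /= !(formD, formN).
do 3![move=> /(canRL (addrK _)) ->] => bracket0.
by apply: subr0_eq; rewrite [RHS]bracket0; ring.
Qed.

End QuasiTriangular.

Theorem theorem4p14 (K : fieldType) (K_char : 2%N \notin [pchar K])
    (A : vectType K) (circ : {bilinear A -> A -> A})
    (A_zinbiel : is_zinbiel circ)
    (r : tensor A A) (r_qt : quasi_triangular circ r) :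
  is_relative_rota_baxter circ (plus_prod circ r)
    (rho_dual circ) (Rstar circ) (-1) (r_plus r).
Proof.
have [r_bracket r_inv] := r_qt.
split=> //; first exact: plus_prod_zinbiel; first exact: dual_action.
move=> xi eta; apply: form_inj => zeta.
(* On the right, zeta (r_+ w) = w (r_- zeta) moves the evaluation onto w, whose summands are known
   as forms. *)
rewrite (bracket_form K_char r_inv r_bracket) [RHS]r_plusP -r_minusP.
rewrite scaleN1r [RHS]add_lfunE [X in _ = X + _]add_lfunE opp_lfunE /=.
rewrite rho_dualE RstarE plus_prodE opprK (r_minusE _ eta) linearBr /=.
by rewrite [xi (_ - _)]formD formN opprB addrA addrAC.
Qed.
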